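(* Let $G=G_n(g,f)$ be a proper Riordan graph. (i) $G$ is io-decomposable if and only if $g'\equiv g^2$ and $gf\equiv t\cdot(f/t)'$. (ii) $G$ is ie-decomposable if and only if $g'\equiv0$ and $t^2g\equiv tf'+f$.
   Context: Power series are in the variable $t$ with coefficients in $\mathbb{Z}$ (or $\mathbb{Z}_2$); $\equiv$ means congruence mod $2$ (coefficientwise for power series); $'$ is the formal derivative; $[t^k]u$ is the coefficient of $t^k$ in $u$. For power series $g,f$ with $f(0)=0$, the Riordan graph $G_n(g,f)$ is the simple graph on the vertex set $\{1,\dots,n\}$ in which, for $i>j\ge1$, the vertices $i$ and $j$ are adjacent if and only if $[t^{i-2}]\,g f^{\,j-1}\equiv 1$. It is proper if the matrix of the coefficients $[t^i]gf^j$ mod $2$, $0\le i,j\le n-2$, is a proper (i.e. invertible) binary Riordan matrix, which means $g(0)\equiv f'(0)\equiv1$. Let $G_n(g,f)$ be a proper Riordan graph, let $V_o$ and $V_e$ be its sets of odd and even vertices, and let $\langle S\rangle$ denote the subgraph induced by a vertex set $S$. A null graph is a graph with no edges, and $\cong$ denotes isomorphism of graphs. $G_n(g,f)$ is io-decomposable if $\langle V_o\rangle\cong G_{\lceil n/2\rceil}(g,f)$ and $\langle V_e\rangle$ is a null graph. It is ie-decomposable if $\langle V_o\rangle$ is a null graph and $\langle V_e\rangle\cong G_{\lfloor n/2\rfloor}(g,f)$.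
   Formalization: ''G is io-decomposable'' (resp. ''ie-decomposable'') is read as: G_n(g,f) is so for every n ≥ 1, since for one fixed n the ''only if'' directions fail (e.g. n=2, g=1, f=t, where G_2 is both io- and ie-decomposable but the identities fail). *)

(* Defs.v *)
From HB Require Import structures.
From mathcomp Require Import all_boot all_order all_algebra.
Set Implicit Arguments.
Unset Strict Implicit.
Unset Printing Implicit Defensive.
Import Order.TTheory GRing.Theory Num.Theory.
Local Open Scope ring_scope.

(* A formal power series in t over Z is its coefficient sequence:
   u k is the coefficient of t^k in u. *)
Definition fps : Type := nat -> int.

Definition fps_one : fps := fun k => (k == 0%N)%:R.

Definition fps_t : fps := fun k => (k == 1%N)%:R.

Definition fps_mul (u v : fps) : fps :=
  fun k => \sum_(i < k.+1) u i * v (k - i)%N.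

Definition fps_exp (u : fps) (j : nat) : fps := iter j (fps_mul u) fps_one.

Definition fps_add (u v : fps) : fps := fun k => u k + v k.

Definition fps_deriv (u : fps) : fps := fun k => u k.+1 *+ k.+1.

(* The quotient u / t; meaningful when the constant term of u is 0. *)
Definition fps_divt (u : fps) : fps := fun k => u k.+1.

Definition fps_eqmod2 (u v : fps) : Prop :=
  forall k, (u k = v k %[mod 2])%Z.

Record sgraph := SGraph {
  vertex : finType;
  adj : rel vertex;
  adj_sym : symmetric adj;
  adj_irrefl : irreflexive adj }.

Definition sgraph_iso (G H : sgraph) : Prop :=
  exists2 h : vertex G -> vertex H,
    bijective h & forall x y, adj (h x) (h y) = adj x y.

Definition null_graph (G : sgraph) : Prop :=
  forall x y : vertex G, ~~ adj x y.

Section Induced.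
Variables (G : sgraph) (S : {set vertex G}).

Definition induced_adj : rel {x : vertex G | x \in S} :=
  fun x y => adj (val x) (val y).

Lemma induced_adj_sym : symmetric induced_adj.
Proof. by move=> x y; apply: adj_sym. Qed.

Lemma induced_adj_irrefl : irreflexive induced_adj.
Proof. by move=> x; apply: adj_irrefl. Qed.

Definition induced : sgraph := SGraph induced_adj_sym induced_adj_irrefl.

End Induced.

(* For vertex labels i > j >= 1. *)
Definition riordan_entry (g f : fps) (i j : nat) : bool :=
  (fps_mul g (fps_exp f j.-1) (i - 2)%N == 1 %[mod 2])%Z.

Section RiordanGraph.
Variables (n : nat) (g f : fps).

(* The ordinal x : 'I_n stands for the vertex labelled x.+1 in {1, ..., n}. *)
Definition label (x : 'I_n) : nat := x.+1.

Definition riordan_adj : rel 'I_n := fun x y =>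
  ((label y < label x)%N && riordan_entry g f (label x) (label y)) ||
  ((label x < label y)%N && riordan_entry g f (label y) (label x)).

Lemma riordan_adj_sym : symmetric riordan_adj.
Proof. by move=> x y; rewrite /riordan_adj orbC. Qed.

Lemma riordan_adj_irrefl : irreflexive riordan_adj.
Proof. by move=> x; rewrite /riordan_adj ltnn. Qed.

Definition riordan_graph : sgraph := SGraph riordan_adj_sym riordan_adj_irrefl.

Definition odd_vertices : {set vertex riordan_graph} :=
  [set x : 'I_n | odd (label x)].

Definition even_vertices : {set vertex riordan_graph} :=
  [set x : 'I_n | ~~ odd (label x)].

End RiordanGraph.

Definition proper_riordan (g f : fps) : Prop :=
  (g 0%N = 1 %[mod 2])%Z /\ (fps_deriv f 0%N = 1 %[mod 2])%Z.

Definition io_decomposable (n : nat) (g f : fps) : Prop :=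
  sgraph_iso (induced (odd_vertices n g f)) (riordan_graph (uphalf n) g f) /\
  null_graph (induced (even_vertices n g f)).

Definition ie_decomposable (n : nat) (g f : fps) : Prop :=
  null_graph (induced (odd_vertices n g f)) /\
  sgraph_iso (induced (even_vertices n g f)) (riordan_graph n./2 g f).

(* Main.v *)
Require Import Defs.
From HB Require Import structures.
From mathcomp Require Import all_boot all_order all_algebra.
From mathcomp Require Import boolp.
Set Implicit Arguments.
Unset Strict Implicit.
Unset Printing Implicit Defensive.
Import Order.TTheory GRing.Theory Num.Theory.
Local Open Scope ring_scope.

(** Write G, F and P for the series g, f and f/t mod 2, so that F = tP, and
    let odd(U) be the series formed by the coefficients of U of odd index, so
    that U' = odd(U)^2 over F_2 ([sderiv_odd_part]).  Since squares have
    derivative 0 and squaring is injective on F_2[[t]], the Leibniz rule gives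
    odd(U V^2) = odd(U) V ([odd_part_mul_sqr]).  Applied with V = F^y, this
    identifies the two induced subgraphs as Riordan graphs with the same second
    series ([odd_vertices_iso], [even_vertices_iso]):
    - on the odd vertices, the first series is H = odd(G);
    - on the even vertices, it is K = odd(GP), because the entries come from
      G F^(2y+1) = t (GP) (F^y)^2.

    It remains to read H and K off the graphs.  The null graphs correspond to
    the first series 0.  The isomorphisms in the definition of decomposability
    are arbitrary, but if the graphs of (g, f) and (h, f) of every order are
    isomorphic, then they have equally many edges at every order, so the n-th
    rows of the two Riordan matrices have equally many ones.  As f(0) = 0, all
    entries of a row except the first are determined by the earlier
    coefficients of the first series; so by induction the first series agree
    mod 2 ([riordan_graph_inj]).

    Hence io-decomposability for every n means odd(G) = G and odd(GP) = 0, and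
    ie-decomposability means odd(G) = 0 and odd(GP) = G.  Squaring turns these
    into G' = G^2 and (GP)' = 0, respectively G' = 0 and (GP)' = G^2; the stated
    equations follow by the Leibniz rule and cancellation of G, whose constant
    term is 1 ([io_equations], [ie_equations]). *)

(** * The ring of formal power series *)

(** A separate name for the function type, so that it can carry the ring
    structure given by the Cauchy product. *)
Definition series (R : comNzRingType) : Type := nat -> R.

HB.instance Definition _ R := gen_eqMixin (series R).
HB.instance Definition _ R := gen_choiceMixin (series R).

Section SeriesRing.
Variable R : comNzRingType.
Implicit Types (u v w : series R) (p q : {poly R}).

Definition szero : series R := fun=> 0.
Definition sopp u : series R := fun k => - u k.
Definition sadd u v : series R := fun k => u k + v k.
Definition sone : series R := fun k => (k == 0%N)%:R.
Definition smul u v : series R := fun k => \sum_(i < k.+1) u i * v (k - i)%N.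

Lemma saddA : associative sadd.
Proof. by move=> u v w; apply/funext=> k; apply: addrA. Qed.

Lemma saddC : commutative sadd.
Proof. by move=> u v; apply/funext=> k; apply: addrC. Qed.

Lemma sadd0 : left_id szero sadd.
Proof. by move=> u; apply/funext=> k; apply: add0r. Qed.

Lemma saddN : left_inverse szero sopp sadd.
Proof. by move=> u; apply/funext=> k; apply: addNr. Qed.

HB.instance Definition _ :=
  GRing.isZmodule.Build (series R) saddA saddC sadd0 saddN.

(** Polynomials approximating series transfer the ring laws and the Leibniz
    rule from [{poly R}]: by [agreeM] the Cauchy product is computed by the
    product of truncations, so two series sharing approximations of every order
    are equal. *)
Definition agree n p u := forall i, (i < n)%N -> p`_i = u i.

Definition trunc n u : {poly R} := \poly_(i < n) u i.

Lemma agree_trunc n u : agree n (trunc n u) u.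
Proof. by move=> i lt_in; rewrite coef_poly lt_in. Qed.

Lemma agreeM n p q u v : agree n p u -> agree n q v ->
  agree n (p * q) (smul u v).
Proof.
move=> pu qv i lt_in; rewrite coefM; apply: eq_bigr => j _.
rewrite pu ?qv ?(leq_ltn_trans (leq_subr _ _)) //.
by rewrite (leq_ltn_trans _ lt_in) // -ltnS.
Qed.

Lemma agree_inj u v : (forall n, exists2 p, agree n p u & agree n p v) -> u = v.
Proof.
move=> uv; apply/funext=> k; have [p pu pv] := uv k.+1.
by rewrite -pu ?pv.
Qed.

Lemma smulA : associative smul.
Proof.
move=> u v w; apply: agree_inj => n.
exists (trunc n u * (trunc n v * trunc n w)); last rewrite mulrA;
  by do !apply: agreeM; apply: agree_trunc.
Qed.

Lemma smulC : commutative smul.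
Proof.
move=> u v; apply: agree_inj => n.
exists (trunc n u * trunc n v); last rewrite mulrC;
  by apply: agreeM; apply: agree_trunc.
Qed.

Lemma smul1 : left_id sone smul.
Proof.
move=> u; apply: agree_inj => n; exists (trunc n u); last exact: agree_trunc.
rewrite -[trunc n u]mul1r; apply: agreeM (agree_trunc _).
by move=> i _; rewrite coef1.
Qed.

Lemma smulDl : left_distributive smul sadd.
Proof.
move=> u v w; apply/funext=> k; rewrite /smul /sadd -big_split.
by apply: eq_bigr => i _; apply: mulrDl.
Qed.

Lemma sone_neq0 : sone != 0.
Proof. by apply/eqP => /(congr1 (@^~ 0%N)) /eqP; rewrite oner_eq0. Qed.

HB.instance Definition _ := GRing.Zmodule_isComNzRing.Build (series R)
  smulA smulC smul1 smulDl sone_neq0.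

Lemma coef_sM u v k : (u * v) k = \sum_(i < k.+1) u i * v (k - i)%N.
Proof. by []. Qed.

Definition sX : series R := fun k => (k == 1%N)%:R.

Lemma coef_sXM u k : (sX * u) k = if k is k'.+1 then u k' else 0.
Proof.
have -> : (sX * u) k = ('X * trunc k.+1 u)`_k.
  symmetry; apply: (@agreeM k.+1) => // [i _|]; last exact: agree_trunc.
  by rewrite coefX.
by rewrite coefXM; case: k => //= k; rewrite agree_trunc.
Qed.

Lemma sX_lreg : GRing.lreg sX.
Proof.
move=> u v /(congr1 (fun s k => s k.+1)) uv; apply/funext => k.
by move/(congr1 (@^~ k)): uv; rewrite !coef_sXM.
Qed.

(** The k-th coefficient of u v is v k plus terms in the earlier coefficients
    of v, so v can be recovered from u v by induction. *)
Lemma unitary_lreg u : u 0%N = 1 -> GRing.lreg u.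
Proof.
move=> u0 v w uvw; apply/funext=> k.
elim/ltn_ind: k => k IHk; move/(congr1 (@^~ k)): uvw.
rewrite !coef_sM !big_ord_recl !u0 !mul1r !subn0 /=.
rewrite (eq_bigr (fun i : 'I_k => u i.+1 * w (k - i.+1)%N)) => [/addIr//|i _].
by rewrite IHk // subnSK ?leq_subr // subSn.
Qed.

Definition sderiv u : series R := fun k => u k.+1 *+ k.+1.

Lemma sderivX : sderiv sX = 1.
Proof. by apply/funext => -[|k]; rewrite /sderiv /sX ?mul0rn. Qed.

Lemma agree_deriv n p u : agree n.+1 p u -> agree n p^`() (sderiv u).
Proof. by move=> pu i lt_in; rewrite coef_deriv pu. Qed.

Lemma sderivM u v : sderiv (u * v) = sderiv u * v + u * sderiv v.
Proof.
apply: agree_inj => n; pose p := trunc n.+1 u; pose q := trunc n.+1 v.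
have [pu qv]: agree n.+1 p u /\ agree n.+1 q v by split; apply: agree_trunc.
exists (p * q)^`(); first by apply/agree_deriv/agreeM.
have [pu' qv']: agree n p u /\ agree n q v.
  by split=> i lt_in; [apply: pu | apply: qv]; apply: leqW.
rewrite derivM => i lt_in; rewrite coefD.
by rewrite (agreeM (agree_deriv pu) qv') // (agreeM pu' (agree_deriv qv)).
Qed.

End SeriesRing.

(** * Odd parts of series over the field with two elements *)

Section Char2.
Implicit Types (u v w : series 'F_2).

Lemma saddr2 u : u + u = 0.
Proof. by apply/funext => k; apply: addrr_pchar2 (pchar_Fp _) _. Qed.

Definition odd_part (R : comNzRingType) (u : series R) : series R :=
  fun k => u k.*2.+1.

Lemma poly_sqr_F2 (p : {poly 'F_2}) : p ^+ 2 = p \Po 'X^2.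
Proof.
have ch2 : 2 \in [pchar {poly 'F_2}] by rewrite pchar_poly pchar_Fp.
have sqr_F2 (c : 'F_2) : c ^+ 2 = c by case: c => -[|[|]] // ?; apply/val_inj.
elim/poly_ind: p => [|p c IHp]; first by rewrite expr0n comp_poly0.
rewrite comp_polyD comp_polyM comp_polyX comp_polyC -IHp sqrrD mulr2n.
by rewrite (addrr_pchar2 ch2) addr0 exprMn -polyC_exp sqr_F2.
Qed.

Lemma coef_sqr u k : (u ^+ 2) k = if odd k then 0 else u k./2.
Proof.
have -> : (u ^+ 2) k = ((trunc k.+1 u) ^+ 2)`_k.
  rewrite !expr2; symmetry.
  by apply: (agreeM (n := k.+1)) => //; apply: agree_trunc.
rewrite poly_sqr_F2 coef_comp_poly_Xn // dvdn2; case: odd => //=.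
by rewrite agree_trunc ?divn2 // ltnS -divn2 leq_div.
Qed.

Lemma sqr_inj : injective (fun u => u ^+ 2).
Proof.
move=> u v /= uv; apply/funext => k.
by have := congr1 (@^~ k.*2) uv; rewrite !coef_sqr odd_double doubleK.
Qed.

Lemma sderiv_odd_part u : sderiv u = odd_part u ^+ 2.
Proof.
apply/funext => k; rewrite coef_sqr /sderiv /odd_part -mulr_natr.
have -> : k.+1%:R = (~~ odd k)%:R :> 'F_2.
  by rewrite -Zp_nat_mod // modn2.
by case: (boolP (odd k)) => [_|/even_halfK ->]; rewrite ?mulr0 ?mulr1.
Qed.

Lemma sderiv_sqr u : sderiv (u ^+ 2) = 0.
Proof. by rewrite expr2 sderivM [u * _]mulrC saddr2. Qed.

(** Squares are constants for the derivation, and [sderiv] is the square of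
    [odd_part]; so the identity holds after squaring. *)
Lemma odd_part_mul_sqr u v : odd_part (u * v ^+ 2) = odd_part u * v.
Proof.
apply: sqr_inj; rewrite /= -sderiv_odd_part exprMn -sderiv_odd_part.
by rewrite sderivM sderiv_sqr mulr0 addr0.
Qed.

Lemma odd_partP u v : odd_part u = v <-> sderiv u = v ^+ 2.
Proof. by rewrite sderiv_odd_part; split=> [-> | /sqr_inj]. Qed.

Lemma saddr_eq0 u v : u + v = 0 <-> u = v.
Proof.
split=> [uv0 | ->]; last exact: saddr2.
by rewrite -[u]addr0 -(saddr2 v) addrA uv0 add0r.
Qed.

(** With u the first series and p the quotient by t of the second one, the left
    side describes the two induced subgraphs.  Given u' = u^2, the derivative
    (u p)' is u (u p + p'). *)
Lemma io_equations u p : u 0%N = 1 ->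
  odd_part u = u /\ odd_part (u * p) = 0 <->
  sderiv u = u ^+ 2 /\ u * (sX _ * p) = sX _ * sderiv p.
Proof.
move=> u0; rewrite !odd_partP mulrCA (expr2 0) mulr0 (sderivM u p).
split=> -[Du]; rewrite Du.
  by rewrite expr2 -mulrA -mulrDr -(mulr0 u) => /(unitary_lreg u0)/saddr_eq0 <- //.
by move/sX_lreg <-; split=> //; rewrite expr2 -mulrA saddr2.
Qed.

(** In characteristic 2 the right side of the second equation is t^2 p', while
    (u p)' = u p' as soon as u' = 0. *)
Lemma ie_equations u p : u 0%N = 1 ->
  odd_part u = 0 /\ odd_part (u * p) = u <->
  sderiv u = 0 /\
  sX _ ^+ 2 * u = sX _ * sderiv (sX _ * p) + sX _ * p.
Proof.
move=> u0; rewrite !odd_partP (expr2 0) mulr0 (sderivM u p).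
have -> : sX _ * sderiv (sX _ * p) + sX _ * p = sX _ ^+ 2 * sderiv p.
  rewrite -mulrDr sderivM sderivX mul1r addrC addrA saddr2 add0r mulrA.
  by rewrite expr2.
split=> -[Du]; rewrite Du mul0r add0r expr2.
  by move/(unitary_lreg u0) <-.
by rewrite -!mulrA => /sX_lreg/sX_lreg <-.
Qed.

End Char2.

(** * Reduction mod 2 of the Riordan matrix *)

Section Reduction.
Implicit Types (u v g f : fps).

Definition mod2 u : series 'F_2 := fun k => (u k)%:~R.

Lemma eqmod2E (x y : int) : (x == y %[mod 2])%Z = (x%:~R == y%:~R :> 'F_2).
Proof.
by rewrite eqz_mod_dvd (dvdz_pcharf (pchar_Fp (isT : prime 2))) rmorphB subr_eq0.
Qed.

Lemma eqmod2P u v : fps_eqmod2 u v <-> mod2 u = mod2 v.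
Proof.
split=> [uv | uv k]; last by apply/eqP; rewrite eqmod2E; apply/eqP/(congr1 (@^~ k) uv).
by apply/funext => k; apply/eqP; rewrite -eqmod2E; apply/eqP/uv.
Qed.

Lemma mod2M u v : mod2 (fps_mul u v) = mod2 u * mod2 v.
Proof.
apply/funext=> k; rewrite coef_sM /mod2 rmorph_sum.
by apply: eq_bigr => i _; apply: rmorphM.
Qed.

Lemma mod2X u j : mod2 (fps_exp u j) = mod2 u ^+ j.
Proof.
elim: j => [|j IHj]; last by rewrite exprS -IHj -mod2M.
by apply/funext=> k; rewrite /mod2 /= /fps_one rmorph_nat.
Qed.

Lemma mod2D u v : mod2 (fps_add u v) = mod2 u + mod2 v.
Proof. by apply/funext=> k; rewrite /mod2 /fps_add rmorphD. Qed.

Lemma mod2_deriv u : mod2 (fps_deriv u) = sderiv (mod2 u).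
Proof. by apply/funext=> k; rewrite /mod2 /fps_deriv rmorphMn. Qed.

Lemma mod2_t : mod2 fps_t = sX _.
Proof. by apply/funext=> k; rewrite /mod2 /fps_t rmorph_nat. Qed.

Lemma mod20 : mod2 (fun=> 0) = 0.
Proof. by []. Qed.

Lemma mod2_divt f : f 0%N = 0 -> mod2 f = sX _ * mod2 (fps_divt f).
Proof. by move=> f0; apply/funext=> -[|k]; rewrite coef_sXM /mod2 ?f0. Qed.

Lemma mod2_odd_part u : mod2 (odd_part (u : series int)) = odd_part (mod2 u).
Proof. by []. Qed.

Lemma riordan_entryE g f i j :
  riordan_entry g f i j = ((mod2 g * mod2 f ^+ j.-1) (i - 2)%N == 1).
Proof. by rewrite /riordan_entry eqmod2E -mod2X -mod2M. Qed.

(** The vertices labelled 2x+1 and 2y+1 are joined according to a coefficient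
    of odd index of g (f^y)^2. *)
Lemma riordan_entry_odd g f x y : (y < x)%N ->
  riordan_entry g f x.*2.+1 y.*2.+1 =
  riordan_entry (odd_part (g : series int)) f x.+1 y.+1.
Proof.
case: x => // x _; rewrite !riordan_entryE doubleS !subSS !subn0 /=.
by rewrite -muln2 exprM -[LHS]/(odd_part _ x == 1) odd_part_mul_sqr.
Qed.

(** The vertices labelled 2x+2 and 2y+2 are joined according to a coefficient
    of even index of g f^(2y+1), which the factor t of f turns into one of odd
    index of (g (f/t)) (f^y)^2. *)
Lemma riordan_entry_even g f x y : f 0%N = 0 -> (y < x)%N ->
  riordan_entry g f x.*2.+2 y.*2.+2 =
  riordan_entry (odd_part (fps_mul g (fps_divt f) : series int)) f x.+1 y.+1.
Proof.
move=> f0; case: x => // x _; rewrite !riordan_entryE doubleS !subSS !subn0 /=.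
rewrite mod2_odd_part mod2M exprS {1}(mod2_divt f0) -mulrA mulrCA coef_sXM.
by rewrite mulrA -muln2 exprM -[LHS]/(odd_part _ x == 1) odd_part_mul_sqr.
Qed.

End Reduction.

(** * Riordan graphs and their isomorphisms *)

Section Graphs.
Implicit Types (g h f : fps) (G H K : sgraph).

Lemma sgraph_iso_sym G H : sgraph_iso G H -> sgraph_iso H G.
Proof.
case=> i [j ij ji] adj_i; exists j; first by exists i.
by move=> x y; rewrite -adj_i !ji.
Qed.

Lemma sgraph_iso_trans G H K :
  sgraph_iso G H -> sgraph_iso H K -> sgraph_iso G K.
Proof.
case=> i bij_i adj_i [j bij_j adj_j]; exists (j \o i); first exact: bij_comp.
by move=> x y /=; rewrite adj_j adj_i.
Qed.

Lemma null_graph_iso G H : sgraph_iso G H -> null_graph G <-> null_graph H.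
Proof.
case=> i [j ij ji] adj_i; split=> nullG x y; last by rewrite -adj_i.
by rewrite -(ji x) -(ji y) adj_i.
Qed.

Definition arcs G : nat := \sum_(x : vertex G) \sum_(y : vertex G) adj x y.

Lemma arcs_iso G H : sgraph_iso G H -> arcs G = arcs H.
Proof.
case=> i bij_i adj_i; rewrite /arcs (reindex i) /=; last exact: onW_bij.
apply: eq_bigr => x _; rewrite (reindex i) /=; last exact: onW_bij.
by apply: eq_bigr => y _; rewrite adj_i.
Qed.

(** The graph of order n is induced in that of order n+1 by the first n
    vertices; the last vertex contributes its degree twice. *)
Lemma arcs_riordanS n g f :
  arcs (riordan_graph n.+1 g f) =
  (arcs (riordan_graph n g f) +
   (\sum_(y < n) riordan_entry g f n.+1 y.+1).*2)%N.
Proof.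
pose A x y : nat := ((y < x)%N && riordan_entry g f x.+1 y.+1) ||
                    ((x < y)%N && riordan_entry g f y.+1 x.+1).
have arcsE m : arcs (riordan_graph m g f) = (\sum_(x < m) \sum_(y < m) A x y)%N.
  by [].
have A_last (y : 'I_n) : A n y = riordan_entry g f n.+1 y.+1.
  by rewrite /A ltn_ord ltnNge ltnW ?orbF.
have A_sym x y : A x y = A y x by rewrite /A orbC.
have A_diag : A n n = 0%N by rewrite /A ltnn.
rewrite !arcsE big_ord_recr /= big_ord_recr /= A_diag addn0.
under eq_bigr => x _ do rewrite big_ord_recr /= A_sym A_last.
rewrite big_split -addnA -addnn /=.
by under [X in (_ + (_ + X))%N]eq_bigr => y _ do rewrite A_last.
Qed.

Lemma riordan_graph_eqmod2 n g h f : mod2 g = mod2 h ->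
  sgraph_iso (riordan_graph n g f) (riordan_graph n h f).
Proof.
move=> gh; exists id; first by exists id.
by move=> x y; rewrite /= /riordan_adj !riordan_entryE gh.
Qed.

(** Counting edges shows that the two matrices have equally many ones in each
    row.  The entries beyond the first one in row k involve only coefficients of
    index less than k of the first series, since f(0) = 0; hence the first
    entries, which are the k-th coefficients of g and h, agree by induction. *)
Lemma riordan_graph_inj g h f : f 0%N = 0 ->
  (forall n, (0 < n)%N ->
     sgraph_iso (riordan_graph n g f) (riordan_graph n h f)) ->
  mod2 g = mod2 h.
Proof.
move=> f0 gh; apply/funext => k; elim/ltn_ind: k => k IHk.
have rows : (\sum_(y < k.+1) riordan_entry g f k.+2 y.+1 =
             \sum_(y < k.+1) riordan_entry h f k.+2 y.+1)%N.
  have /arcs_iso := gh k.+2 isT; rewrite !(arcs_riordanS k.+1).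
  by rewrite (arcs_iso (gh k.+1 isT)) => /addnI /double_inj.
move: rows; rewrite !big_ord_recl.
rewrite (eq_bigr (fun y : 'I_k => riordan_entry h f k.+2 y.+2 : nat)).
  move/addIn; rewrite !riordan_entryE !subSS subn0 /= !expr0 !mulr1.
  by case: (mod2 g k) => -[|[|[]]] // ?; case: (mod2 h k) => -[|[|[]]] // ? *; apply/val_inj.
move=> y _; rewrite !riordan_entryE !subSS subn0 /= exprS (mod2_divt f0).
rewrite -mulrA !(mulrCA _ (sX _)) !coef_sXM.
case: k IHk y => [|k] IHk y; first by case: y.
congr (nat_of_bool (_ == _)); rewrite !coef_sM; apply: eq_bigr => i _.
by rewrite IHk.
Qed.

(** The neighbours of the vertex 1 already determine g, as the first column of
    the matrix is g f^0. *)
Lemma null_riordan_graph g f :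
  (forall n, (0 < n)%N -> null_graph (riordan_graph n g f)) <-> mod2 g = 0.
Proof.
split=> [null_g | g0 n _ x y].
  apply/funext=> k; have /= := null_g k.+2 isT ord_max ord0.
  rewrite /riordan_adj /= riordan_entryE !subSS subn0 expr0 mulr1 orbF.
  by case: (mod2 g k) => -[|[|[]]] // ? *; apply/val_inj.
by rewrite /= /riordan_adj !riordan_entryE g0 !mul0r /= !andbF.
Qed.

(** The common part of the odd (b = 0) and even (b = 1) cases: with vertices
    numbered from 0, the class is that of the numbers b + 2i, and i, the half of
    b + 2i, is the vertex that corresponds to it. *)
Lemma iso_parity_class (b : bool) n m g h f
    (S : {set vertex (riordan_graph n g f)}) :
  (forall x : 'I_n, (x \in S) = (odd x == b)) ->
  (forall i, (b + i.*2 < n)%N = (i < m)%N) ->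
  (forall x y, (y < x)%N ->
     riordan_entry g f (b + x.*2).+1 (b + y.*2).+1 =
     riordan_entry h f x.+1 y.+1) ->
  sgraph_iso (induced S) (riordan_graph m h f).
Proof.
move=> S_odd lt_m entry_gh; apply: sgraph_iso_sym.
have lt_n (i : 'I_m) : (b + i.*2 < n)%N by rewrite lt_m.
have in_S i : Ordinal (lt_n i) \in S.
  by rewrite S_odd /= oddD odd_double addbF oddb.
exists (fun i : 'I_m => exist _ (Ordinal (lt_n i)) (in_S i)).
  have val_half (x : {x : 'I_n | x \in S}) : (b + (val x)./2.*2)%N = val x.
    by have := valP x; rewrite /= S_odd => /eqP <-; rewrite odd_double_half.
  have half_lt (x : {x : 'I_n | x \in S}) : ((val x)./2 < m)%N.
    by rewrite -lt_m val_half.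
  exists (fun x => Ordinal (half_lt x)) => [i | x]; apply: val_inj => /=.
    by rewrite half_bit_double.
  exact/val_inj/val_half.
move=> x y; rewrite /= /induced_adj /= /riordan_adj /label /=.
rewrite !ltnS !ltn_add2l !ltn_double.
by case: ltngtP => [lt_yx|lt_xy|] /=; rewrite ?entry_gh.
Qed.

Lemma odd_vertices_iso n g f :
  sgraph_iso (induced (odd_vertices n g f))
             (riordan_graph (uphalf n) (odd_part (g : series int)) f).
Proof.
apply: (@iso_parity_class false) => [x | i | x y]; last exact: riordan_entry_odd.
  by rewrite inE /=; case: odd.
by rewrite add0n gtn_uphalf_double.
Qed.

Lemma even_vertices_iso n g f : f 0%N = 0 ->
  sgraph_iso (induced (even_vertices n g f))
    (riordan_graph n./2 (odd_part (fps_mul g (fps_divt f) : series int)) f).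
Proof.
move=> f0.
apply: (@iso_parity_class true) => [x | i | x y]; last exact: riordan_entry_even.
  by rewrite inE /=; case: odd.
by rewrite add1n gtn_half_double.
Qed.

End Graphs.

(** * The characterization of decomposability *)

Theorem theorem4p2 (g f : fps) (f0 : f 0%N = 0)
    (proper_gf : proper_riordan g f) :
  ((forall n : nat, (0 < n)%N -> io_decomposable n g f) <->
     (fps_eqmod2 (fps_deriv g) (fps_exp g 2) /\
      fps_eqmod2 (fps_mul g f) (fps_mul fps_t (fps_deriv (fps_divt f)))))
  /\
  ((forall n : nat, (0 < n)%N -> ie_decomposable n g f) <->
     (fps_eqmod2 (fps_deriv g) (fun=> 0) /\
      fps_eqmod2 (fps_mul (fps_exp fps_t 2) g)
                 (fps_add (fps_mul fps_t (fps_deriv f)) f))).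
Proof.
have g0 : mod2 g 0%N = 1.
  by have [/eqP] := proper_gf; rewrite eqmod2E => /eqP.
pose k : fps := odd_part (fps_mul g (fps_divt f) : series int).
have mod2_k : mod2 k = odd_part (mod2 g * mod2 (fps_divt f)).
  by rewrite mod2_odd_part mod2M.
split; rewrite !eqmod2P !(mod2X, mod2M, mod2D, mod2_deriv, mod2_t, mod20).
  rewrite !(mod2_divt f0) -io_equations // -mod2_k -mod2_odd_part.
  rewrite -(null_riordan_graph _ f); split=> [io | [hg null_k] n n_gt0].
    (* The graph of order 2n has n odd and n even vertices. *)
    split=> [|n n_gt0].
      apply: (riordan_graph_inj f0) => n n_gt0.
      have [iso_g _] := io n.*2 (etrans (double_gt0 _) n_gt0).
      rewrite uphalf_double in iso_g.
      apply: sgraph_iso_trans iso_g; apply: sgraph_iso_sym.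
      by have := odd_vertices_iso n.*2 g f; rewrite uphalf_double.
    have [_] := io n.*2 (etrans (double_gt0 _) n_gt0).
    have /null_graph_iso := even_vertices_iso n.*2 g f0.
    by rewrite doubleK => ->.
  split.
    exact: sgraph_iso_trans (odd_vertices_iso n g f) (riordan_graph_eqmod2 _ _ hg).
  apply/(null_graph_iso (even_vertices_iso n g f0)).
  (* For n = 1 there are no even vertices. *)
  by case: (posnP n./2) => [-> [] | /null_k].
rewrite !(mod2_divt f0) -ie_equations // -mod2_k -mod2_odd_part.
rewrite -(null_riordan_graph _ f); split=> [ie | [null_h kg] n n_gt0].
  split=> [n n_gt0|].
    have [null_odd _] := ie n.*2 (etrans (double_gt0 _) n_gt0).
    move/null_graph_iso: (odd_vertices_iso n.*2 g f).
    by rewrite uphalf_double => <-.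
  apply: (riordan_graph_inj f0) => n n_gt0.
  have [_ iso_g] := ie n.*2 (etrans (double_gt0 _) n_gt0).
  rewrite doubleK in iso_g; apply: sgraph_iso_trans iso_g.
  apply: sgraph_iso_sym.
  by have := even_vertices_iso n.*2 g f0; rewrite doubleK.
split; last first.
  exact: sgraph_iso_trans (even_vertices_iso n g f0) (riordan_graph_eqmod2 _ _ kg).
apply/(null_graph_iso (odd_vertices_iso n g f)).
by apply: null_h; rewrite uphalf_gt0.
Qed.
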